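(* Let $G=(V,E)$ be a finite, simple, connected graph with $|E|\geq 2$, with an arbitrary chosen orientation of its edges. Let $e,f$ be two distinct (oriented) edges that share a vertex in $G$. Then the subsemigroup of the graph automaton group $\mathcal{G}_G$ generated by $e$ and $f$ is free, i.e., distinct words over $\{e,f\}$ represent distinct elements of $\mathcal{G}_G$.
   Context: Graph automaton group: given a finite simple graph $G=(V,E)$, choose an orientation of every edge and let $E'$ be the resulting set of ordered pairs. Let $V^*$ be the set of finite words over the alphabet $V$. Each oriented edge $e=(x,y)\in E'$ acts as a length-preserving bijection of $V^*$ defined recursively by $e(\emptyset)=\emptyset$, $e(xw)=y\,e(w)$, $e(yw)=xw$, and $e(zw)=zw$ for $z\in V\setminus\{x,y\}$, $w\in V^*$. The group $\mathcal{G}_G$ is the group of bijections of $V^*$ generated by the elements of $E'$. Products are composed from left to right: $gh$ means first apply $g$, then $h$. *)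

(* Defs.v *)
From HB Require Import structures.
From mathcomp Require Import all_boot boolp.

Set Implicit Arguments.
Unset Strict Implicit.
Unset Printing Implicit Defensive.

Local Open Scope group_scope.

Section Bijections.
Variable T : Type.

Record bijection := Bijection {
  bij_fun :> T -> T;
  bij_inv : T -> T;
  bij_funK : cancel bij_fun bij_inv;
  bij_invK : cancel bij_inv bij_fun }.

Lemma bijectionP (g h : bijection) : g =1 h -> g = h.
Proof.
case: g h => [g g' gK g'K] [h h' hK h'K] /= /funext gh.
have g'h' : g' = h' by apply/funext => x; rewrite -{1}[x]h'K -gh gK.
by subst h h'; congr Bijection; exact: Prop_irrelevance.
Qed.

HB.instance Definition _ := gen_eqMixin bijection.
HB.instance Definition _ := gen_choiceMixin bijection.

Definition bij_one : bijection :=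
  Bijection (fun=> erefl) (fun=> erefl : id _ = _).

(* Left-to-right convention: [bij_mul g h] first applies [g], then [h]. *)
Definition bij_mul (g h : bijection) : bijection :=
  Bijection (can_comp (bij_funK h) (bij_funK g))
            (can_comp (bij_invK g) (bij_invK h)).

Definition bij_opp (g : bijection) : bijection :=
  Bijection (bij_invK g) (bij_funK g).

Lemma bij_mulA : associative bij_mul.
Proof. by move=> f g h; apply: bijectionP. Qed.

Lemma bij_mul1 : left_id bij_one bij_mul.
Proof. by move=> g; apply: bijectionP. Qed.

Lemma bij_mulr1 : right_id bij_one bij_mul.
Proof. by move=> g; apply: bijectionP. Qed.

Lemma bij_mulV : left_inverse bij_one bij_opp bij_mul.
Proof. by move=> g; apply: bijectionP => x /=; rewrite bij_invK. Qed.

Lemma bij_mulrV : right_inverse bij_one bij_opp bij_mul.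
Proof. by move=> g; apply: bijectionP => x /=; rewrite bij_funK. Qed.

HB.instance Definition _ :=
  isGroup.Build bijection bij_mulA bij_mul1 bij_mulr1 bij_mulV bij_mulrV.

End Bijections.

Section GeneratedSubgroup.
Variables (G : groupType) (A : G -> Prop).

Definition generated : {pred G} := [pred g | `[<
  forall H : {pred G}, group_closed H -> (forall a, A a -> a \in H) ->
    g \in H >]].

Lemma generated_closed : group_closed generated.
Proof.
split; first by apply/asboolP => H [].
move=> g h /asboolP gP /asboolP hP; apply/asboolP => H Hgr HA.
by apply: (proj2 Hgr); [exact: gP | exact: hP].
Qed.

Lemma mem_generated a : A a -> a \in generated.
Proof. by move=> Aa; apply/asboolP => H _; apply. Qed.

Record subgroup_gen := SubgroupGen {
  subgroup_val :> G;
  subgroup_valP : subgroup_val \in generated }.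

HB.instance Definition _ := [isSub for subgroup_val].
HB.instance Definition _ := [Choice of subgroup_gen by <:].
HB.instance Definition _ :=
  SubChoice_isSubGroup.Build G generated subgroup_gen generated_closed.

End GeneratedSubgroup.

(* Words over the two letters [true], [false], read as [a], [b]. The empty word
   is included, with value [1]; in a group this is equivalent to freeness on
   the nonempty words only, since a relation [w = 1] with [w] nonempty gives the
   relation [w * a = a] between distinct nonempty words. *)
Definition free_subsemigroup (G : groupType) (a b : G) : Prop :=
  injective (fun w : seq bool => \prod_(s <- w) (if s then a else b)).

Section EdgeAction.
Variable V : eqType.

Fixpoint edge_act (e : V * V) (w : seq V) : seq V :=
  if w is z :: w' then
    if z == e.1 then e.2 :: edge_act e w'
    else if z == e.2 then e.1 :: w'
    else z :: w'
  else [::].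

Lemma edge_actK (x y : V) : cancel (edge_act (x, y)) (edge_act (y, x)).
Proof.
elim=> [|z w IH] //=; case: (eqVneq z x) => [->|zx] /=; first by rewrite eqxx IH.
case: (eqVneq z y) => [zy|zy] /=; last by rewrite (negPf zx) (negPf zy).
by rewrite -zy eqxx eq_sym (negPf zx).
Qed.

Definition edge_bij (e : V * V) : bijection (seq V) :=
  @Bijection _ (edge_act e) (edge_act (e.2, e.1))
    (let: (x, y) as e0 := e
       return cancel (edge_act e0) (edge_act (e0.2, e0.1)) in edge_actK x y)
    (let: (x, y) as e0 := e
       return cancel (edge_act (e0.2, e0.1)) (edge_act e0) in edge_actK y x).

End EdgeAction.

Section Graphs.
Variable V : finType.

Definition simple_graph (adj : rel V) : Prop := symmetric adj /\ irreflexive adj.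

Definition connected_graph (adj : rel V) : Prop := forall x y, connect adj x y.

Definition ends (e : V * V) : {set V} := [set e.1; e.2].

Definition edge_set (adj : rel V) : {set {set V}} :=
  [set ends e | e : V * V & adj e.1 e.2].

Definition orientation (adj : rel V) (E' : {set V * V}) : Prop :=
  (forall x y, (x, y) \in E' -> adj x y) /\
  (forall x y, adj x y -> ((x, y) \in E') (+) ((y, x) \in E')).

Definition share_vertex (e f : V * V) : bool := ends e :&: ends f != set0.

Definition is_edge_bij (E' : {set V * V}) (g : bijection (seq V)) : Prop :=
  exists2 e, e \in E' & g = edge_bij e.

Definition graph_automaton_group (E' : {set V * V}) : groupType :=
  subgroup_gen (is_edge_bij E').

Definition edge_elt (E' : {set V * V}) (e : V * V) (eE' : e \in E') :
    graph_automaton_group E' :=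
  SubgroupGen (mem_generated (ex_intro2 _ _ e eE' erefl)).

End Graphs.

(* Main.v *)
Require Import Defs.
From mathcomp Require Import all_boot.

(**
Write the sections of a positive word w at a letter z: reading z, each
generator (x, y) of w either is recorded (when the current letter is x) or
contributes nothing, so the section of w at z is again a positive word, of
length at most that of w.  If u and v have different first letters (or exactly
one of them is empty), then either they already act differently on V, or some
letter z has sections of u and v that again have different first letters, with
smaller total length; one concludes by induction.  For edges a -> b, a -> c
one takes z = a; for a -> b -> c one takes z = b, or z = a when comparing
with the empty word, where the length drops because no generator is recorded
at the sink c; edges b -> a, c -> a reduce to the first case by
inversion.
*)

Set Implicit Arguments.
Unset Strict Implicit.
Unset Printing Implicit Defensive.

Lemma neq_negb (s i : bool) : s != i -> s = ~~ i.
Proof. by case: s i => [] []. Qed.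

Section PositiveWords.
Variable V : eqType.
Implicit Types (p : bool -> V * V) (u v w : seq bool) (z : V) (t : seq V).

Definition run p w t : seq V := foldl (fun t s => edge_act (p s) t) t w.

Definition letter_act (e : V * V) z : V :=
  if z == e.1 then e.2 else if z == e.2 then e.1 else z.

Definition run_letter p w z : V := foldl (fun z s => letter_act (p s) z) z w.

Fixpoint word_section p w z : seq bool :=
  if w is s :: w' then
    let r := word_section p w' (letter_act (p s) z) in
    if z == (p s).1 then s :: r else r
  else [::].

Lemma run_cons p w z t :
  run p w (z :: t) = run_letter p w z :: run p (word_section p w z) t.
Proof.
elim: w z t => //= s w IH z t; rewrite /letter_act.
by case: ifP => _ //=; case: ifP.
Qed.

Lemma size_word_section p w z : size (word_section p w z) <= size w.
Proof.
elim: w z => //= s w IH z; case: ifP => _ /=; first by rewrite ltnS.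
exact: leq_trans (IH _) (leqnSn _).
Qed.

(** One induction step. With [ohead], the empty word has head [None], so comparison with it needs no
    separate treatment. *)
Definition separated p u v : Prop :=
  (exists z, run_letter p u z != run_letter p v z) \/
  (exists2 z, ohead (word_section p u z) != ohead (word_section p v z) &
     size (word_section p u z) + size (word_section p v z) < size u + size v).

Lemma separatedC p u v : separated p u v -> separated p v u.
Proof.
case=> [[z dz]|[z dz lt_z]]; [left|right]; exists z; rewrite 1?eq_sym //.
by rewrite [ltnLHS]addnC [ltnRHS]addnC.
Qed.

Lemma separated_run_inj p i :
    (forall s w, separated p [::] (s :: w)) ->
    (forall u v, separated p (i :: u) (~~ i :: v)) ->
  forall u v, run p u =1 run p v -> u = v.
Proof.
move=> sep0 sepi.
have sep u v : ohead u != ohead v -> separated p u v.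
  case: u v => [|s u] [|r v] // sr; first exact/separatedC/sep0.
  have {sr}-> : r = ~~ s by apply: neq_negb; apply: contraNneq sr => ->.
  case: (eqVneq s i) => [->|si]; first exact: sepi.
  by rewrite (neq_negb si) negbK; apply/separatedC/sepi.
have neq u v : ohead u != ohead v -> ~ run p u =1 run p v.
  have [n] := ubnP (size u + size v); elim: n u v => // n IH u v le_n duv euv.
  case: (sep _ _ duv) => [[z]|[z dz lt_z]].
    by have := euv [:: z]; rewrite !run_cons => -[-> _]; rewrite eqxx.
  apply: IH dz _ => [|t]; first exact: leq_trans lt_z _.
  by have := euv (z :: t); rewrite !run_cons => -[].
elim=> [|s u IH] [|r v] euv //; try by case: (neq _ _ _ euv).
case: (eqVneq s r) => [sr|sr]; last by case: (neq _ _ _ euv).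
rewrite -{r}sr in euv *; congr cons; apply: IH => t.
(* Evaluating at the preimage of [t] under the common first generator cancels that generator. *)
have := euv (edge_act ((p s).2, (p s).1) t).
by rewrite /run /=; case: (p s) => x y; rewrite edge_actK.
Qed.

Lemma run_inj_common_source p a :
    (forall s, (p s).1 = a) -> (forall s, (p s).2 != a) ->
    (p true).2 != (p false).2 ->
  forall u v, run p u =1 run p v -> u = v.
Proof.
move=> p1 p2 dd.
have actE s : letter_act (p s) a = (p s).2 by rewrite /letter_act p1 eqxx.
have secE s w : word_section p (s :: w) a = s :: word_section p w (p s).2.
  by rewrite /= actE p1 eqxx.
have lt_sec s r w :
    size (word_section p (s :: r :: w) a) < size (s :: r :: w).
  by rewrite secE /= p1 (negPf (p2 s)) !ltnS size_word_section.
apply: (@separated_run_inj _ true) => [s [|r w]|u v].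
- by left; exists a; rewrite /= actE eq_sym.
- by right; exists a; [rewrite secE | exact: lt_sec].
case: u v => [|r u] [|q v].
- by left; exists a; rewrite /= !actE.
- right; exists a; first by rewrite !secE.
  by rewrite -addnS leq_add ?size_word_section ?lt_sec.
- right; exists a; first by rewrite !secE.
  by rewrite -addSn leq_add ?size_word_section ?lt_sec.
right; exists a; first by rewrite !secE.
by rewrite -addSn leq_add ?size_word_section ?lt_sec.
Qed.

(** At [b], generator [i] moves to [a] unrecorded, while [~~ i] is recorded and moves to [c]. *)
Lemma run_inj_path p i a b c :
    uniq [:: a; b; c] -> p i = (a, b) -> p (~~ i) = (b, c) ->
  forall u v, run p u =1 run p v -> u = v.
Proof.
rewrite /= !inE negb_or andbT => /andP[/andP[ab ac] bc] pi pNi.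
have [ba ca cb] : [/\ b != a, c != a & c != b] by split; rewrite eq_sym.
have p1 s : (p s).1 = if s == i then a else b.
  by case: eqP => [->|/eqP si]; rewrite ?pi // (neq_negb si) pNi.
have secc w : w != [::] -> size (word_section p w c) < size w.
  case: w => // r w _.
  rewrite /= p1 (fun_if (eq_op c)) (negPf ca) (negPf cb) if_same ltnS.
  exact: size_word_section.
(* The generator [~~ i] fixes [a] unrecorded, so the first recorded letter, if any, is [i]. *)
have seca w : ohead (word_section p w a) != Some (~~ i).
  elim: w => //= s w IH; rewrite p1; case: (eqVneq s i) => [->|si].
    by rewrite eqxx /=; case: (i).
  by rewrite (negPf ab) (neq_negb si) pNi /letter_act /= (negPf ab) (negPf ac).
apply: (@separated_run_inj _ i) => [s w|u v].
- case: (eqVneq s i) => [->|si].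
    case: w => [|r w].
      by left; exists a; rewrite /= pi /letter_act /= eqxx.
    (* From [a], the word [i i] returns to [a] with its second letter unrecorded; [i (~~ i)] ends at
       [c], where the rest loses a letter. *)
    case: (eqVneq r i) => [->|ri].
      right; exists a; rewrite /= !pi /letter_act /= eqxx //=.
      by rewrite (negPf ba) !ltnS size_word_section.
    rewrite (neq_negb ri).
    case: (eqVneq w [::]) => [->|/secc lt_w].
      by left; exists a; rewrite /= pi pNi /letter_act /= !eqxx.
    by right; exists a; rewrite /= pi pNi /letter_act /= !eqxx.
  rewrite (neq_negb si).
  case: (eqVneq w [::]) => [->|/secc lt_w].
    by left; exists b; rewrite /= pNi /letter_act /= eqxx.
  by right; exists b; rewrite /= pNi /letter_act /= eqxx.
right; exists b; rewrite /= pi pNi /letter_act /= !eqxx (negPf ba) /=.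
  exact: seca.
by rewrite addSn ltnS leq_add ?ltnS ?size_word_section.
Qed.

Lemma run_rev_swapK p q w :
  (forall s, p s = ((q s).2, (q s).1)) -> cancel (run q (rev w)) (run p w).
Proof.
move=> pq; elim: w => // s w IH t.
rewrite rev_cons /run foldl_rcons /= pq.
rewrite [in X in edge_act _ X](surjective_pairing (q s)) edge_actK.
exact: IH.
Qed.

(** Reversing both edges inverts the generators, so [run p w] is inverse to [run q (rev w)]. *)
Lemma run_inj_swap p q :
    (forall s, p s = ((q s).2, (q s).1)) ->
    (forall u v, run q u =1 run q v -> u = v) ->
  forall u v, run p u =1 run p v -> u = v.
Proof.
move=> pq inj u v euv; apply/(can_inj revK)/inj => t.
have qp s : q s = ((p s).2, (p s).1) by rewrite pq /= -surjective_pairing.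
by have := @run_rev_swapK q p (rev u) qp (run q (rev v) t);
   rewrite revK euv run_rev_swapK.
Qed.

End PositiveWords.

Lemma val_prod_edge_elt (V : finType) (E' : {set V * V}) (e f : V * V)
    (he : e \in E') (hf : f \in E') (w : seq bool) (t : seq V) :
  subgroup_val (\prod_(s <- w) (if s then edge_elt he else edge_elt hf))%g t =
  run (fun s : bool => if s then e else f) w t.
Proof.
elim: w t => [|s w IH] t; first by rewrite big_nil.
by rewrite big_cons /=; case: s; rewrite -IH.
Qed.

Theorem theorem3p2 (V : finType) (adj : rel V) (E' : {set V * V})
  (hG : simple_graph adj) (hconn : connected_graph adj)
  (hE : 2 <= #|edge_set adj|) (hor : orientation adj E')
  (e f : V * V) (he : e \in E') (hf : f \in E')
  (hef : e != f) (hshare : share_vertex e f) :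
  free_subsemigroup (edge_elt he) (edge_elt hf).
Proof.
have [_ irr] := hG; have [sub ori] := hor.
move=> u v uv.
have {uv} euv : run (fun s : bool => if s then e else f) u =1
                run (fun s : bool => if s then e else f) v.
  by move=> t; rewrite -!(val_prod_edge_elt he hf) uv.
case: e f he hf hef hshare euv => [x y] [x' y'] he hf hef hshare.
have loopless z z' : (z, z') \in E' -> z != z'.
  by move/sub => zz'; apply: contraTneq zz' => ->; rewrite irr.
have xy := loopless _ _ he; have x'y' := loopless _ _ hf.
(* Only one direction of each edge is chosen, so the two ends of a directed path of length two
   differ. *)
have anti : (y, x) \notin E' by have := ori _ _ (sub _ _ he); rewrite he.
case/set0Pn: hshare => z; rewrite !inE => /andP[/= ze zf].
have {ze zf z} : [|| x == x', y == y', y == x' | x == y'].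
  by case/orP: ze zf => /eqP-> /orP[] ->; rewrite ?orbT.
case/or4P=> /eqP sh; subst.
- apply: (@run_inj_common_source _ _ x'); [by case|by case; rewrite eq_sym|].
  by apply: contraNneq hef => /= ->.
- apply: (@run_inj_swap _ _ (fun s => if s then (y', x) else (y', x'))).
    by case.
  apply: (@run_inj_common_source _ _ y'); [by case|by case|].
  by apply: contraNneq hef => /= ->.
- apply: (@run_inj_path _ _ true x x' y') => //=;
  rewrite !inE negb_or xy x'y' !andbT.
  by apply: contraNneq anti => ->.
apply: (@run_inj_path _ _ false x' y' y) => //=;
  rewrite !inE negb_or xy x'y' !andbT.
by apply: contraNneq anti => <-.
Qed.
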